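(* Let $\delta,\rho,H,r,\sigma>0$ with $1<\frac{\rho}{\delta+H}\leq e$, put $\kappa=\ln\left(\frac{\rho}{\delta+H}\right)$, and let $c>0$. Every traveling wave $U(t,x)=\Phi(x+ct)$, $\Phi=(\phi_1,\phi_2)$, of the system $$\begin{cases}u_{1,t}(t,x)=u_{1,xx}(t,x)-\delta u_1(t,x)+\rho u_1(t-r,x)e^{-u_1(t-r,x)}-Hu_2(t-\sigma,x),\\ u_{2,t}(t,x)=u_{2,xx}(t,x)-\delta u_2(t,x)+\rho u_1(t-r,x)e^{-u_1(t-r,x)}-Hu_2(t-\sigma,x),\end{cases}$$ connecting $E_1=(0,0)$ to $E_2=(\kappa,\kappa)$ lies on the diagonal. More precisely, if $$\lim_{s\to-\infty}\Phi(s)=E_1,\qquad \lim_{s\to+\infty}\Phi(s)=E_2,$$ then $\phi_1(s)=\phi_2(s)$ for all $s\in\mathbb R$.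
   Context: Here $t,x\in\mathbb R$. That $U(t,x)=\Phi(x+ct)$ is a traveling wave means that its profile satisfies, for all $s\in\mathbb R$, $$\begin{cases}c\phi_1'(s)=\phi_1''(s)-\delta\phi_1(s)+\rho\phi_1(s-cr)e^{-\phi_1(s-cr)}-H\phi_2(s-c\sigma),\\ c\phi_2'(s)=\phi_2''(s)-\delta\phi_2(s)+\rho\phi_1(s-cr)e^{-\phi_1(s-cr)}-H\phi_2(s-c\sigma).\end{cases}$$ *)

(* Defs.v *)
From Stdlib Require Import Reals Lra.
From Coquelicot Require Import Coquelicot.
Open Scope R_scope.

(* [ex_derive_n f 2 x] only says that [Derive f], which is total, is
   differentiable at [x]; differentiability of [f] has to be asked separately. *)
Definition twice_differentiable (f : R -> R) : Prop :=
  forall x, ex_derive f x /\ ex_derive_n f 2 x.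

(* Pointwise classical solutions on the whole plane. *)
Definition solves_system (delta rho H r sigma : R) (u1 u2 : R -> R -> R) : Prop :=
  (forall t x, ex_derive (fun t' => u1 t' x) t /\ ex_derive (fun t' => u2 t' x) t) /\
  (forall t, twice_differentiable (fun x => u1 t x)
             /\ twice_differentiable (fun x => u2 t x)) /\
  (forall t x,
     Derive (fun t' => u1 t' x) t
     = Derive_n (fun x' => u1 t x') 2 x - delta * u1 t x
       + rho * u1 (t - r) x * exp (- u1 (t - r) x) - H * u2 (t - sigma) x) /\
  (forall t x,
     Derive (fun t' => u2 t' x) t
     = Derive_n (fun x' => u2 t x') 2 x - delta * u2 t x
       + rho * u1 (t - r) x * exp (- u1 (t - r) x) - H * u2 (t - sigma) x).

Definition wave_profile (delta rho H r sigma c : R) (phi1 phi2 : R -> R) : Prop :=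
  twice_differentiable phi1 /\ twice_differentiable phi2 /\
  (forall s,
     c * Derive phi1 s
     = Derive_n phi1 2 s - delta * phi1 s
       + rho * phi1 (s - c * r) * exp (- phi1 (s - c * r))
       - H * phi2 (s - c * sigma)) /\
  (forall s,
     c * Derive phi2 s
     = Derive_n phi2 2 s - delta * phi2 s
       + rho * phi1 (s - c * r) * exp (- phi1 (s - c * r))
       - H * phi2 (s - c * sigma)).

Definition traveling_wave (delta rho H r sigma c : R)
    (u1 u2 : R -> R -> R) (phi1 phi2 : R -> R) : Prop :=
  (forall t x, u1 t x = phi1 (x + c * t)) /\
  (forall t x, u2 t x = phi2 (x + c * t)) /\
  wave_profile delta rho H r sigma c phi1 phi2.

Definition kappa (delta rho H : R) : R := ln (rho / (delta + H)).

Definition connects (phi1 phi2 : R -> R) (E E' : R * R) : Prop :=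
  (is_lim phi1 m_infty (fst E) /\ is_lim phi2 m_infty (snd E)) /\
  (is_lim phi1 p_infty (fst E') /\ is_lim phi2 p_infty (snd E')).

Lemma Derive_shift (f : R -> R) (a x : R) :
  Derive (fun y => f (y + a)) x = Derive f (x + a).
Proof.
unfold Derive; apply f_equal, Lim_ext; intros h.
now replace (x + h + a) with (x + a + h) by ring.
Qed.

Lemma Derive2_shift (f : R -> R) (a x : R) :
  Derive_n (fun y => f (y + a)) 2 x = Derive_n f 2 (x + a).
Proof.
simpl; rewrite (Derive_ext _ (fun y => Derive f (y + a)) x).
- exact (Derive_shift (Derive f) a x).
- intros y; exact (Derive_shift f a y).
Qed.

Lemma ex_derive_shift (f : R -> R) (a x : R) :
  ex_derive f (x + a) -> ex_derive (fun y => f (y + a)) x.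
Proof. intros h; auto_derive; exact h. Qed.

Lemma twice_differentiable_shift (f : R -> R) (a : R) :
  twice_differentiable f -> twice_differentiable (fun y => f (y + a)).
Proof.
intros hf x; destruct (hf (x + a)) as [h1 h2]; split.
- now apply ex_derive_shift.
- simpl; apply (ex_derive_ext (fun y => Derive f (y + a))).
  + intros y; symmetry; apply (Derive_shift f a y).
  + now apply (ex_derive_shift (Derive f)).
Qed.

Lemma is_derive_time (f : R -> R) (c t x : R) :
  ex_derive f (x + c * t) ->
  is_derive (fun t' => f (x + c * t')) t (c * Derive f (x + c * t)).
Proof.
intros h; auto_derive; [exact h |].
change (fun x0 => f x0) with f; ring.
Qed.

Lemma Derive_time (f : R -> R) (c t x : R) :
  ex_derive f (x + c * t) ->
  Derive (fun t' => f (x + c * t')) t = c * Derive f (x + c * t).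
Proof. intros h; apply is_derive_unique; now apply is_derive_time. Qed.

(* The profile equations say exactly that Phi (x + c t) solves the system. *)
Lemma wave_profile_iff (delta rho H r sigma c : R) (phi1 phi2 : R -> R) :
  wave_profile delta rho H r sigma c phi1 phi2 <->
  solves_system delta rho H r sigma
    (fun t x => phi1 (x + c * t)) (fun t x => phi2 (x + c * t)).
Proof.
split.
- intros (d1 & d2 & e1 & e2).
  assert (hd1 := fun t x => Derive_time phi1 c t x (proj1 (d1 _))).
  assert (hd2 := fun t x => Derive_time phi2 c t x (proj1 (d2 _))).
  repeat split.
  + eexists; apply is_derive_time, d1.
  + eexists; apply is_derive_time, d2.
  + now apply (twice_differentiable_shift phi1 (c * t)).
  + now apply (twice_differentiable_shift phi1 (c * t)).
  + now apply (twice_differentiable_shift phi2 (c * t)).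
  + now apply (twice_differentiable_shift phi2 (c * t)).
  + intros t x; cbv beta; rewrite hd1, e1, Derive2_shift.
    replace (x + c * (t - r)) with (x + c * t - c * r) by ring.
    now replace (x + c * (t - sigma)) with (x + c * t - c * sigma) by ring.
  + intros t x; cbv beta; rewrite hd2, e2, Derive2_shift.
    replace (x + c * (t - r)) with (x + c * t - c * r) by ring.
    now replace (x + c * (t - sigma)) with (x + c * t - c * sigma) by ring.
- intros (_ & d & e1 & e2); destruct (d 0) as [d1 d2].
  assert (ext : forall f : R -> R,
    twice_differentiable (fun x => f (x + c * 0)) -> twice_differentiable f).
  { intros f hf x.
    assert (E : forall y, f (y + c * 0) = f y)
      by (intros y; apply f_equal; ring).
    destruct (hf x) as [h1 h2]; split.
    - now apply (ex_derive_ext (fun y => f (y + c * 0))).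
    - now apply (ex_derive_n_ext (fun y => f (y + c * 0))). }
  apply ext in d1; apply ext in d2.
  assert (hd1 := fun t x => Derive_time phi1 c t x (proj1 (d1 _))).
  assert (hd2 := fun t x => Derive_time phi2 c t x (proj1 (d2 _))).
  repeat split; try apply d1; try apply d2; intros s.
  + specialize (e1 0 s); cbv beta in e1; rewrite hd1, Derive2_shift in e1.
    replace (s + c * (0 - r)) with (s - c * r) in e1 by ring.
    replace (s + c * (0 - sigma)) with (s - c * sigma) in e1 by ring.
    now replace (s + c * 0) with s in e1 by ring.
  + specialize (e2 0 s); cbv beta in e2; rewrite hd2, Derive2_shift in e2.
    replace (s + c * (0 - r)) with (s - c * r) in e2 by ring.
    replace (s + c * (0 - sigma)) with (s - c * sigma) in e2 by ring.
    now replace (s + c * 0) with s in e2 by ring.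
Qed.

(* Main.v *)
Require Import Defs.
From Stdlib Require Import Reals Lra.
From Coquelicot Require Import Coquelicot.
Open Scope R_scope.

(** The two profile equations have the same delayed terms, so these cancel in
    the difference [w = phi1 - phi2], which solves the linear equation
    [w'' = c w' + delta w] and tends to 0 at both ends.  Such a [w] vanishes
    by a maximum principle for its square ([decaying_linear_ode_zero]):
    for [v = w^2] one has [v'' - c v' = 2 w'^2 + 2 delta w^2 >= 0], that is,
    [v' e^(-c s)] is nondecreasing.  So once [v] increases it goes on increasing,
    and a nonnegative function that tends to 0 at [+oo] cannot do that.
    Hence [v] is nonincreasing everywhere; as it tends to 0 at [-oo],
    it is at most 0. *)

Lemma derive_nonneg_le (f df : R -> R) (a b : R) :
  a <= b ->
  (forall x, is_derive f x (df x)) ->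
  (forall x, a <= x <= b -> 0 <= df x) ->
  f a <= f b.
Proof.
intros hab hd hpos.
destruct (MVT_gen f a b df) as [x [hx e]].
- intros x _; apply hd.
- intros x _; apply continuity_pt_filterlim.
  apply (ex_derive_continuous f); eexists; apply hd.
- rewrite Rmin_left, Rmax_right in hx by assumption.
  specialize (hpos x hx); nra.
Qed.

(** A positive derivative that never stops being positive keeps [v] away from 0
    at [+oo], so [v] can return to 0 only if [v'] changes sign from positive to
    nonpositive; forbidding this leaves [v' <= 0] everywhere, and the limit
    at [-oo] then bounds [v] from above. *)
Lemma no_interior_max_zero (v dv : R -> R) :
  (forall x, is_derive v x (dv x)) ->
  (forall x y, x <= y -> 0 < dv x -> 0 < dv y) ->
  (forall x, 0 <= v x) ->
  is_lim v m_infty 0 -> is_lim v p_infty 0 ->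
  forall x, v x = 0.
Proof.
intros hd hstay hnn hm hp.
assert (hdec : forall x, dv x <= 0).
{ intros x; apply Rnot_lt_le; intros hx.
  assert (hinc : forall y z, x < y -> y < z -> v y < v z).
  { intros y z hy hz.
    apply (incr_function v x p_infty dv); simpl; trivial.
    intros t ht _; apply (hstay x); [now left | assumption]. }
  assert (hle : Rbar_le (v (x + 2)) 0).
  { apply (is_lim_le_loc (fun _ => v (x + 2)) v p_infty); trivial.
    - exists (x + 2); intros y hy; left; apply hinc; lra.
    - apply is_lim_const. }
  assert (v (x + 1) < v (x + 2)) by (apply hinc; lra).
  specialize (hnn (x + 1)).
  simpl in hle; lra. }
intros x; apply Rle_antisym; [| apply hnn].
change (Rbar_le (v x) 0).
apply (is_lim_le_loc (fun _ => v x) v m_infty); trivial.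
- exists x; intros y hy.
  apply Ropp_le_cancel.
  apply (derive_nonneg_le (fun t => - v t) (fun t => - dv t)); [lra | |].
  + intros t; apply (is_derive_opp v), hd.
  + intros t _; specialize (hdec t); lra.
- apply is_lim_const.
Qed.

(** The characteristic roots have product [- delta <= 0], so each nonzero
    combination of the modes fails to decay at one end; the maximum principle
    for [w^2] shows this without computing the roots. *)
Lemma decaying_linear_ode_zero (c delta : R) (w dw ddw : R -> R) :
  0 <= delta ->
  (forall x, is_derive w x (dw x)) ->
  (forall x, is_derive dw x (ddw x)) ->
  (forall x, ddw x = c * dw x + delta * w x) ->
  is_lim w m_infty 0 -> is_lim w p_infty 0 ->
  forall x, w x = 0.
Proof.
intros hdelta hw hdw ode hm hp x.
assert (hsq : forall l, is_lim w l 0 -> is_lim (fun t => w t * w t) l 0).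
{ intros l hl; replace 0 with (0 * 0) by ring.
  exact (is_lim_mult w w l 0 0 hl hl I). }
apply Rsqr_0_uniq.
apply (no_interior_max_zero (fun t => w t * w t) (fun t => 2 * (w t * dw t)));
  auto.
- intros t; assert (h := hw t); auto_derive.
  + assert (ex_derive w t) by now exists (dw t).
    repeat split; assumption.
  + change (fun y : R => w y) with w.
    rewrite (is_derive_unique w t _ h); ring.
- (* Half of [v' e^(-c s)], with the derivative [e^(-c s) (w'^2 + delta w^2)]. *)
  intros a b hab ha.
  assert (hg : w a * dw a * exp (- (c * a)) <= w b * dw b * exp (- (c * b))).
  { apply (derive_nonneg_le (fun t => w t * dw t * exp (- (c * t)))
      (fun t => exp (- (c * t)) * (dw t * dw t + delta * (w t * w t))));
      [assumption | |].
    - intros t; assert (h1 := hw t); assert (h2 := hdw t); auto_derive.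
      + split; [now exists (dw t) |]; split; [now exists (ddw t) | trivial].
      + change (fun y : R => w y) with w.
        change (fun y : R => dw y) with dw.
        rewrite (is_derive_unique w t _ h1), (is_derive_unique dw t _ h2), ode.
        ring.
    - intros t _.
      assert (0 < exp (- (c * t))) by apply exp_pos.
      assert (0 <= w t * w t) by apply Rle_0_sqr.
      assert (0 <= dw t * dw t) by apply Rle_0_sqr.
      apply Rmult_le_pos; nra. }
  assert (ea := exp_pos (- (c * a))); assert (eb := exp_pos (- (c * b))).
  assert (0 < w a * dw a * exp (- (c * a))) by (apply Rmult_lt_0_compat; lra).
  nra.
- intros t; apply Rle_0_sqr.
Qed.

Theorem lemma3 (delta rho H r sigma c : R)
    (hdelta : 0 < delta) (hrho : 0 < rho) (hH : 0 < H)
    (hr : 0 < r) (hsigma : 0 < sigma)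
    (hlow : 1 < rho / (delta + H)) (hup : rho / (delta + H) <= exp 1)
    (hc : 0 < c)
    (u1 u2 : R -> R -> R) (phi1 phi2 : R -> R)
    (hwave : traveling_wave delta rho H r sigma c u1 u2 phi1 phi2)
    (hconn : connects phi1 phi2 (0, 0) (kappa delta rho H, kappa delta rho H)) :
  forall s : R, phi1 s = phi2 s.
Proof.
destruct hwave as (_ & _ & d1 & d2 & e1 & e2).
destruct hconn as [[m1 m2] [p1 p2]]; simpl in m1, m2, p1, p2.
assert (hlim : forall l k, is_lim phi1 l (Finite k) -> is_lim phi2 l (Finite k) ->
                 is_lim (fun t => phi1 t - phi2 t) l 0).
{ intros l k h1 h2; replace 0 with (k - k) by ring.
  now apply (is_lim_minus' phi1 phi2). }
intros s; apply Rminus_diag_uniq.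
apply (decaying_linear_ode_zero c delta (fun t => phi1 t - phi2 t)
  (fun t => Derive phi1 t - Derive phi2 t)
  (fun t => Derive_n phi1 2 t - Derive_n phi2 2 t)).
- lra.
- intros t; apply (is_derive_minus phi1 phi2); apply Derive_correct.
  + apply d1.
  + apply d2.
- intros t; apply (is_derive_minus (Derive phi1) (Derive phi2));
    apply Derive_correct.
  + apply d1.
  + apply d2.
- intros t; specialize (e1 t); specialize (e2 t); lra.
- now apply hlim with 0.
- now apply hlim with (kappa delta rho H).
Qed.
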